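(* Let $(A,[\cdot,\cdot])$ be a Malcev superalgebra and let $r\in A\otimes A$ be skew-supersymmetric with $|r|=0$. Then $r$ is a solution of the super Malcev Yang-Baxter equation in $A$ if and only if, regarding $r$ as a linear map $r:A^*\to A$, it satisfies $$[r(x^* ),r(y^* )]=r\big(ad^*(r(x^* ))(y^* )-(-1)^{|x^*||y^*|}ad^*(r(y^* ))(x^* )\big)\quad\text{for all homogeneous }x^*,y^*\in A^*.$$ So, in this case, there is a pre-Malcev superalgebra structure on $A^*$ given by $x^*\cdot y^*=ad^*(r(x^* ))(y^* )$ for all $x^*,y^*\in A^*$.
   Context: All vector spaces are finite dimensional over an algebraically closed field $\mathbb K$ of characteristic zero. A super vector space is a $\mathbb Z_2$-graded space; $|x|$ is the parity of a homogeneous element, and elements appearing in formulas with parities are assumed homogeneous. A Malcev superalgebra is a super vector space $A$ with a bilinear map $[\cdot,\cdot]$, $[A_\alpha,A_\beta]\subseteq A_{\alpha+\beta}$, such that for all homogeneous $x,y,z,t$: $[x,y]=-(-1)^{|x||y|}[y,x]$ and $$(-1)^{|y||z|}[[x,z],[y,t]]=[[[x,y],z],t]+(-1)^{|x|(|y|+|z|+|t|)}[[[y,z],t],x]+(-1)^{(|x|+|y|)(|z|+|t|)}[[[z,t],x],y]+(-1)^{|t|(|x|+|y|+|z|)}[[[t,x],y],z].$$ The dual $A^*$ is graded by $A^*_\alpha=\{a^*: a^*(A_{\alpha+\bar 1})=0\}$; $\langle a^*,b\rangle=a^*(b)$ is the canonical pairing, with $\langle a^*,b\rangle=(-1)^{|a^*||b|}\langle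 b,a^*\rangle$. It is extended to tensors by $\langle a_1^*\otimes a_2^*,b_1\otimes b_2\rangle=(-1)^{|a_2^*||b_1|}\langle a_1^*,b_1\rangle\langle a_2^*,b_2\rangle$. The co-adjoint representation $ad^*:A\to gl(A^* )$ is given by $\langle ad^*(x)a^*,y\rangle=-(-1)^{|x||a^*|}\langle a^*,[x,y]\rangle$. Let $\sigma(x\otimes y)=(-1)^{|x||y|}y\otimes x$. A tensor $r=\sum_i x_i\otimes y_i\in A\otimes A$ is skew-supersymmetric if $r=-\sigma(r)$; $|r|=0$ means that $r$ is even. The tensor $r$ is regarded as a linear map $r:A^*\to A$ through $$\langle x^*\otimes y^*,r\rangle=\sum_i(-1)^{|y^*||x_i|}\langle x^*,x_i\rangle\langle y^*,y_i\rangle=(-1)^{|r||x^*|}\langle y^*,r(x^* )\rangle,\quad x^*,y^*\in A^*.$$ The super Malcev Yang-Baxter equation for $r=\sum_i x_i\otimes y_i$ is $[r_{12},r_{13}]+[r_{12},r_{23}]+[r_{13},r_{23}]=0$ in $A^{\otimes 3}$, where $r_{12}=\sum_i x_i\otimes y_i\otimes 1$, $r_{13}=\sum_i x_i\otimes 1\otimes y_i$, $r_{23}=\sum_i 1\otimes x_i\otimes y_i$, and the brackets are taken in the graded sense: $[r_{12},r_{13}]=\sum_{i,j}(-1)^{|x_j||y_i|}[x_i,x_j]\otimes y_i\otimes y_j$, $[r_{12},r_{23}]=\sum_{i,j}x_i\otimes[y_i,x_j]\otimes y_j$, $[r_{13},r_{23}]=\sum_{i,j}(-1)^{|x_j||y_i|}x_i\otimes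 x_j\otimes[y_i,y_j]$. A pre-Malcev superalgebra is a super vector space $P$ with a bilinear product $\cdot$, $P_\alpha\cdot P_\beta\subseteq P_{\alpha+\beta}$, such that, with $[x,y]=x\cdot y-(-1)^{|x||y|}y\cdot x$, for all homogeneous $x,y,z,t$, $$(-1)^{|x|(|y|+|z|)}[y,z]\cdot(x\cdot t)+[[x,y],z]\cdot t+(-1)^{|x||y|}y\cdot([x,z]\cdot t)-x\cdot(y\cdot(z\cdot t))+(-1)^{|z|(|x|+|y|)}z\cdot(x\cdot(y\cdot t))=0.$$
   Formalization: The map r:A*→A is taken as r(x* )=Σ⟨x*,x_i⟩y_i, i.e. ⟨x*⊗y*,r⟩=(-1)^{|x*||y*|}⟨y*,r(x* )⟩; with the paper's literal sign (no (-1)^{|x*||y*|}) the equivalence fails, e.g. for r=h⊗e−e⊗h−t⊗t with [h,e]=2e, [h,t]=t, [t,t]=2e. *)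

(* Defs.v *)
From HB Require Import structures.
From mathcomp Require Import all_boot all_order all_algebra.
Set Implicit Arguments.
Unset Strict Implicit.
Unset Printing Implicit Defensive.
Import GRing.Theory.
Local Open Scope ring_scope.

(* Conventions: a super vector space is a [vectType] with a family of subspaces
   indexed by [bool], i.e. Z_2 with [addb] as addition.  In the exponents of
   signs, parities are coerced to [nat] and added there, which is harmless as
   only the class of the exponent modulo 2 matters. *)

Definition bilinear_map (K : fieldType) (U V W : vectType K)
    (f : U -> V -> W) : Prop :=
  (forall v, linear (f ^~ v)) /\ (forall u, linear (f u)).

Definition super_grading (K : fieldType) (V : vectType K)
    (gr : bool -> {vspace V}) : Prop :=
  (gr false :&: gr true = 0)%VS /\ (gr false + gr true = fullv)%VS.

Definition hpart (K : fieldType) (V : vectType K) (gr : bool -> {vspace V})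
    (a : bool) : 'End(V) := daddv_pi (gr a) (gr (~~ a)).

(* The bilinear extension of the formula (-1)^{|x||y|} f(x,y), which is only
   meaningful for homogeneous x and y; see [koszulE]. *)
Definition koszul (K : fieldType) (U V W : vectType K)
    (grU : bool -> {vspace U}) (grV : bool -> {vspace V})
    (f : U -> V -> W) (x : U) (y : V) : W :=
  \sum_(a : bool) \sum_(b : bool)
     (-1) ^+ (a * b)%N *: f (hpart grU a x) (hpart grV b y).

Definition even_product (K : fieldType) (V : vectType K)
    (gr : bool -> {vspace V}) (f : V -> V -> V) : Prop :=
  forall a b x y, x \in gr a -> y \in gr b -> f x y \in gr (a (+) b).

Record malcev_superalgebra (K : fieldType) (A : vectType K)
    (gr : bool -> {vspace A}) (br : A -> A -> A) : Prop := MalcevSuperalgebra {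
  malcev_grading : super_grading gr;
  malcev_bilinear : bilinear_map br;
  malcev_even : even_product gr br;
  malcev_skew : forall a b x y, x \in gr a -> y \in gr b ->
    br x y = - ((-1) ^+ (a * b)%N *: br y x);
  malcev_identity : forall a b c d x y z t,
    x \in gr a -> y \in gr b -> z \in gr c -> t \in gr d ->
    (-1) ^+ (b * c)%N *: br (br x z) (br y t) =
      br (br (br x y) z) t
      + (-1) ^+ (a * (b + c + d))%N *: br (br (br y z) t) x
      + (-1) ^+ ((a + b) * (c + d))%N *: br (br (br z t) x) y
      + (-1) ^+ (d * (a + b + c))%N *: br (br (br t x) y) z }.

Definition supercomm (K : fieldType) (P : vectType K) (gr : bool -> {vspace P})
    (mul : P -> P -> P) (x y : P) : P :=
  mul x y - koszul gr gr (fun u v => mul v u) x y.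

Record pre_malcev_superalgebra (K : fieldType) (P : vectType K)
    (gr : bool -> {vspace P}) (mul : P -> P -> P) : Prop :=
  PreMalcevSuperalgebra {
  pre_malcev_grading : super_grading gr;
  pre_malcev_bilinear : bilinear_map mul;
  pre_malcev_even : even_product gr mul;
  pre_malcev_identity : forall a b c d x y z t,
    x \in gr a -> y \in gr b -> z \in gr c -> t \in gr d ->
    (-1) ^+ (a * (b + c))%N *: mul (supercomm gr mul y z) (mul x t)
    + mul (supercomm gr mul (supercomm gr mul x y) z) t
    + (-1) ^+ (a * b)%N *: mul y (mul (supercomm gr mul x z) t)
    - mul x (mul y (mul z t))
    + (-1) ^+ (c * (a + b))%N *: mul z (mul x (mul y t)) = 0 }.

(* { f | f vanishes on gr (~~ a) }, see [dual_grP] *)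
Definition dual_gr (K : fieldType) (A : vectType K) (gr : bool -> {vspace A})
    (a : bool) : {vspace 'Hom(A, K^o)} :=
  lker (linfun (fun f : 'Hom(A, K^o) => (f \o projv (gr (~~ a)))%VF)).

Definition ad_dual (K : fieldType) (A : vectType K) (gr : bool -> {vspace A})
    (br : A -> A -> A) : A -> 'Hom(A, K^o) -> 'Hom(A, K^o) :=
  koszul gr (dual_gr gr)
    (fun x f => linfun (fun y : A => - f (br x y) : K^o)).

(* The tensor product of two spaces, in coordinates relative to the bases
   [vbasis fullv]; [tensor_lift_tens] and [tensor_ext] are its universal
   property. *)
Definition tensor (K : fieldType) (U V : vectType K) : vectType K :=
  'M[K]_(\dim {:U}, \dim {:V}).

Definition tens (K : fieldType) (U V : vectType K) (x : U) (y : V) :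
    tensor U V :=
  \matrix_(i, j) (coord (vbasis {:U}) i x * coord (vbasis {:V}) j y).

Definition tensor_lift (K : fieldType) (U V W : vectType K) (f : U -> V -> W)
    (r : tensor U V) : W :=
  \sum_(i < \dim {:U}) \sum_(j < \dim {:V})
    (r : 'M_(_, _)) i j *: f (vbasis {:U})`_i (vbasis {:V})`_j.

Definition tensv (K : fieldType) (U V : vectType K) (X : {vspace U})
    (Y : {vspace V}) : {vspace tensor U V} :=
  <<[seq tens x y | x <- vbasis X, y <- vbasis Y]>>%VS.

Definition tensor_gr (K : fieldType) (U V : vectType K)
    (grU : bool -> {vspace U}) (grV : bool -> {vspace V}) (a : bool) :
    {vspace tensor U V} :=
  (\sum_(b : bool) tensv (grU b) (grV (b (+) a)))%VS.

Definition sigma (K : fieldType) (A : vectType K) (gr : bool -> {vspace A}) :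
    tensor A A -> tensor A A :=
  tensor_lift (koszul gr gr (fun x y => tens y x)).

Definition skew_supersymmetric (K : fieldType) (A : vectType K)
    (gr : bool -> {vspace A}) (r : tensor A A) : Prop :=
  r = - sigma gr r.

Definition tensor_pairing (K : fieldType) (A : vectType K)
    (gr : bool -> {vspace A}) (f g : 'Hom(A, K^o)) : tensor A A -> K^o :=
  tensor_lift
    (fun x y => koszul (dual_gr gr) gr (fun g' x' => f x' * g' y) g x).

(* The map A^* -> A associated with an even r = sum_i x_i (x) y_i, namely
   r(f) = sum_i f(x_i) y_i.  It is determined by
     <f (x) g, r> = (-1)^{|f||g|} <g, r(f)> = <r(f), g>,
   see [tensor_mapP] and [tensor_map_uniq].
   Pitfall: the sign (-1)^{|f||g|} comes from exchanging f and g.  Without it,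
   i.e. with <f (x) g, r> = <g, r(f)>, one gets the map
   f |-> (-1)^{|f|} r(f), for which solving the super Malcev Yang-Baxter
   equation is not equivalent to the operator identity.  Take A with even
   basis h, e and odd basis t, nonzero brackets [h,e] = 2e, [h,t] = t,
   [t,t] = 2e, and r = h (x) e - e (x) h - t (x) t.  Then r solves the
   equation, the map f |-> sum_i f(x_i) y_i satisfies the identity, and
   f |-> (-1)^{|f|} r(f) does not, nor does it give a pre-Malcev product. *)
Definition tensor_map (K : fieldType) (A : vectType K) (r : tensor A A)
    (f : 'Hom(A, K^o)) : A :=
  tensor_lift (fun x y => (f x : K) *: y) r.

(* In the three brackets below, the outer [tensor_lift] runs over the left
   factor x (x) y, and the inner one over the right factor x' (x) y'. *)
Definition bracket12_13 (K : fieldType) (A : vectType K)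
    (gr : bool -> {vspace A}) (br : A -> A -> A) (r s : tensor A A) :
    tensor A (tensor A A) :=
  tensor_lift (fun x y => tensor_lift (fun x' y' =>
    koszul gr gr (fun u v => tens (br x u) (tens v y')) x' y) s) r.

Definition bracket12_23 (K : fieldType) (A : vectType K)
    (br : A -> A -> A) (r s : tensor A A) :
    tensor A (tensor A A) :=
  tensor_lift (fun x y => tensor_lift (fun x' y' =>
    tens x (tens (br y x') y')) s) r.

Definition bracket13_23 (K : fieldType) (A : vectType K)
    (gr : bool -> {vspace A}) (br : A -> A -> A) (r s : tensor A A) :
    tensor A (tensor A A) :=
  tensor_lift (fun x y => tensor_lift (fun x' y' =>
    koszul gr gr (fun u v => tens x (tens u (br v y'))) x' y) s) r.

Definition super_malcev_yang_baxter (K : fieldType) (A : vectType K)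
    (gr : bool -> {vspace A}) (br : A -> A -> A) (r : tensor A A) : Prop :=
  bracket12_13 gr br r r + bracket12_23 br r r + bracket13_23 gr br r r = 0.

Lemma linear_map_sum (K : fieldType) (U W : vectType K) (g : U -> W)
    (I : finType) (c : I -> K) (x : I -> U) :
  linear g -> g (\sum_i c i *: x i) = \sum_i c i *: g (x i).
Proof.
move=> lg; pose L := GRing.isLinear.Build K U W *:%R g lg.
pose gL : {linear U -> W} := HB.pack g L.
by rewrite -[g]/(gL : U -> W) linear_sum; apply: eq_bigr => i _; rewrite linearZ.
Qed.

Lemma linear_map0 (K : fieldType) (U W : vectType K) (g : U -> W) :
  linear g -> g 0 = 0.
Proof. by move=> lg; move: (lg (-1) 0 0); rewrite scaler0 addr0 scaleN1r addNr. Qed.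

Lemma linfunE (K : fieldType) (U W : vectType K) (g : U -> W) :
  linear g -> linfun g =1 g.
Proof.
move=> lg; pose L := GRing.isLinear.Build K U W *:%R g lg.
pose gL : {linear U -> W} := HB.pack g L.
exact: (lfunE gL).
Qed.

Lemma hpart_id (K : fieldType) (V : vectType K) (gr : bool -> {vspace V}) a x :
  super_grading gr -> x \in gr a -> hpart gr a x = x.
Proof.
by move=> [g0 _] xa; apply: daddv_pi_id => //; case: a {xa} => //; rewrite capvC.
Qed.

Lemma hpartD (K : fieldType) (V : vectType K) (gr : bool -> {vspace V}) a x :
  super_grading gr -> hpart gr a x + hpart gr (~~ a) x = x.
Proof.
move=> [g0 g1]; rewrite /hpart negbK; apply: daddv_pi_add.
  by case: a => //; rewrite capvC.
by case: a; rewrite /= 1?[(gr true + _)%VS]addvC g1 memvf.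
Qed.

Lemma hpart_memv (K : fieldType) (V : vectType K) (gr : bool -> {vspace V}) a x :
  hpart gr a x \in gr a.
Proof. exact: memv_pi. Qed.

Lemma hpart_homog (K : fieldType) (V : vectType K) (gr : bool -> {vspace V})
    a b x :
  super_grading gr -> x \in gr b -> hpart gr a x = if a == b then x else 0.
Proof.
move=> gg xb; case: eqP => [->|/eqP]; first exact: hpart_id.
move=> ab; have -> : a = ~~ b by case: a b ab {xb} => [] [].
apply: (addrI (hpart gr b x)); rewrite hpartD // addr0.
by rewrite (hpart_id gg xb).
Qed.

Lemma koszulE (K : fieldType) (U V W : vectType K) grU grV
    (f : U -> V -> W) a b x y :
  super_grading grU -> super_grading grV -> bilinear_map f ->
  x \in grU a -> y \in grV b ->
  koszul grU grV f x y = (-1) ^+ (a * b)%N *: f x y.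
Proof.
move=> gU gV [fl fr] xa yb; rewrite /koszul.
rewrite (bigD1 a) //= [X in _ + X]big1 ?addr0; last first.
  move=> c /negPf ca; apply: big1 => d _.
  by rewrite (hpart_homog c gU xa) ca (linear_map0 (fl _)) scaler0.
rewrite (bigD1 b) //= [X in _ + X]big1 ?addr0; last first.
  move=> c /negPf ca.
  by rewrite (hpart_homog c gV yb) ca (linear_map0 (fr _)) scaler0.
by rewrite !hpart_id.
Qed.

Lemma koszul_bilinear (K : fieldType) (U V W : vectType K) grU grV
    (f : U -> V -> W) :
  bilinear_map f -> bilinear_map (koszul grU grV f).
Proof.
move=> [fl fr]; split=> [v|u] k x y; rewrite /koszul /= scaler_sumr -big_split;
  apply: eq_bigr => a _ /=; rewrite scaler_sumr -big_split; apply: eq_bigr => b _ /=.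
  by rewrite linearP fl scalerDr !scalerA mulrC.
by rewrite linearP fr scalerDr !scalerA mulrC.
Qed.

Lemma dual_grP (K : fieldType) (A : vectType K) (gr : bool -> {vspace A}) a
    (f : 'Hom(A, K^o)) :
  reflect (forall x, x \in gr (~~ a) -> f x = 0) (f \in dual_gr gr a).
Proof.
have lin : linear (fun f : 'Hom(A, K^o) => (f \o projv (gr (~~ a)))%VF).
  by move=> k u v; rewrite comp_lfunDl comp_lfunZl.
rewrite memv_ker (linfunE lin).
apply: (iffP eqP) => [f0 x xa|f0].
  by move/lfunP: f0 => /(_ x); rewrite comp_lfunE projv_id // zero_lfunE.
by apply/lfunP => x; rewrite comp_lfunE zero_lfunE f0 // memv_proj.
Qed.

Lemma dual_grading (K : fieldType) (A : vectType K) (gr : bool -> {vspace A}) :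
  super_grading gr -> super_grading (dual_gr gr).
Proof.
move=> gg; split; apply/eqP.
  rewrite -subv0; apply/subvP => f; rewrite memv_cap memv0.
  move=> /andP[/dual_grP f0 /dual_grP f1]; apply/eqP/lfunP => x.
  rewrite zero_lfunE -(hpartD false x gg) linearD /=.
  by rewrite f1 ?hpart_memv // f0 ?hpart_memv // addr0.
rewrite eqEsubv subvf /=; apply/subvP => f _.
have -> : f = (f \o hpart gr false)%VF + (f \o hpart gr true)%VF.
  by apply/lfunP => x; rewrite add_lfunE !comp_lfunE -linearD /= (hpartD false).
by apply: memv_add; apply/dual_grP => x xa; rewrite comp_lfunE;
  rewrite (hpart_homog _ gg xa) /= linear0.
Qed.

Lemma ad_dualE (K : fieldType) (A : vectType K) (gr : bool -> {vspace A})
    (br : A -> A -> A) a b x (f : 'Hom(A, K^o)) y :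
  super_grading gr -> bilinear_map br -> x \in gr a -> f \in dual_gr gr b ->
  ad_dual gr br x f y = - ((-1) ^+ (a * b)%N * f (br x y)).
Proof.
move=> gg [brl brr] xa fb.
have linE u (g : 'Hom(A, K^o)) z :
    linfun (fun y : A => - g (br u y) : K^o) z = - g (br u z).
  have lin : linear (fun y : A => - g (br u y) : K^o).
    by move=> k v w; rewrite brr linearP opprD scalerN.
  exact: linfunE.
rewrite /ad_dual (@koszulE _ _ _ _ _ _ _ a b) //.
- by rewrite scale_lfunE linE /= scalerN.
- exact: dual_grading.
split=> [v|u] k w z; apply/lfunP => t; rewrite add_lfunE scale_lfunE !linE.
  by rewrite brl linearP opprD scalerN.
by rewrite add_lfunE scale_lfunE opprD scalerN.
Qed.

Lemma tensor_lift_is_linear (K : fieldType) (U V W : vectType K)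
    (f : U -> V -> W) : linear (tensor_lift f).
Proof.
move=> k r s; rewrite /tensor_lift scaler_sumr -big_split; apply: eq_bigr => i _.
rewrite /= scaler_sumr -big_split; apply: eq_bigr => j _.
by rewrite !mxE scalerDl scalerA.
Qed.

Lemma tens_bilinear (K : fieldType) (U V : vectType K) :
  bilinear_map (@tens K U V).
Proof.
split=> [v|u] k x y; apply/matrixP => i j; rewrite !mxE linearP /=.
  by rewrite mulrDl mulrA.
by rewrite mulrDr mulrCA.
Qed.

Lemma tensor_lift_tens (K : fieldType) (U V W : vectType K) (f : U -> V -> W)
    x y :
  bilinear_map f -> tensor_lift f (tens x y) = f x y.
Proof.
move=> [fl fr]; rewrite [in RHS](coord_vbasis (memvf x)).
rewrite [in RHS](coord_vbasis (memvf y)).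
rewrite (linear_map_sum _ _ (fl _)) /tensor_lift.
apply: eq_bigr => i _; rewrite (linear_map_sum _ _ (fr _)) scaler_sumr.
by apply: eq_bigr => j _; rewrite mxE scalerA.
Qed.

Lemma tensor_decomp (K : fieldType) (U V : vectType K) (r : tensor U V) :
  r = tensor_lift (@tens K U V) r.
Proof.
apply/matrixP => i j; rewrite /tensor_lift !summxE (bigD1 i) //= summxE.
rewrite (bigD1 j) //= !mxE !coord_free ?(basis_free (vbasisP _)) // !eqxx.
rewrite !mulr1 big1 ?addr0 ?big1 ?addr0 // => [i' /negPf ii|j' /negPf jj].
  rewrite summxE big1 // => j' _.
  by rewrite !mxE coord_free ?(basis_free (vbasisP _)) // ii mul0r mulr0.
by rewrite !mxE !coord_free ?(basis_free (vbasisP _)) // jj !mulr0.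
Qed.

Lemma tensor_ext (K : fieldType) (U V W : vectType K)
    (g h : tensor U V -> W) :
  linear g -> linear h -> (forall x y, g (tens x y) = h (tens x y)) -> g =1 h.
Proof.
move=> lg lh gh r; rewrite (tensor_decomp r) /tensor_lift pair_big /=.
by rewrite !(linear_map_sum _ _ lg, linear_map_sum _ _ lh); apply: eq_bigr => p _;
  rewrite gh.
Qed.

Lemma tensor_lift_sum (K : fieldType) (U V W : vectType K) (f : U -> V -> W)
    (I : finType) (x : I -> U) (y : I -> V) :
  bilinear_map f ->
  tensor_lift f (\sum_i tens (x i) (y i)) = \sum_i f (x i) (y i).
Proof.
move=> bf; transitivity (tensor_lift f (\sum_i 1 *: tens (x i) (y i))).
  by congr tensor_lift; apply: eq_bigr => i _; rewrite scale1r.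
rewrite (linear_map_sum _ _ (@tensor_lift_is_linear _ _ _ _ f)).
by apply: eq_bigr => i _; rewrite scale1r tensor_lift_tens.
Qed.

Lemma eq_tensor_lift (K : fieldType) (U V W : vectType K) (f g : U -> V -> W) :
  f =2 g -> tensor_lift f =1 tensor_lift g.
Proof.
by move=> fg r; apply: eq_bigr => i _; apply: eq_bigr => j _; rewrite fg.
Qed.

Lemma bilinear_map_sum (K : fieldType) (U V W : vectType K) (I : finType)
    (f : I -> U -> V -> W) :
  (forall i, bilinear_map (f i)) -> bilinear_map (fun x y => \sum_i f i x y).
Proof.
move=> bf; split=> [v|u] k x y; rewrite scaler_sumr -big_split;
  apply: eq_bigr => i _; [exact: (bf i).1|exact: (bf i).2].
Qed.

Lemma koszul_linear (K : fieldType) (T U V W : vectType K) grU grV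
    (f : T -> U -> V -> W) u v :
  (forall x y, linear (fun t => f t x y)) ->
  linear (fun t => koszul grU grV (f t) u v).
Proof.
move=> lf k s t; rewrite /koszul scaler_sumr -big_split; apply: eq_bigr => a _ /=.
rewrite scaler_sumr -big_split; apply: eq_bigr => b _ /=.
by rewrite lf scalerDr !scalerA mulrC.
Qed.

Lemma tensor_lift_bilinear (K : fieldType) (U V U' V' W : vectType K)
    (f : U -> V -> U' -> V' -> W) (s : tensor U' V') :
  (forall x' y', bilinear_map (fun x y => f x y x' y')) ->
  bilinear_map (fun x y => tensor_lift (f x y) s).
Proof.
move=> bf; apply: bilinear_map_sum => i; apply: bilinear_map_sum => j.
have [fl fr] := bf (vbasis {:U'})`_i (vbasis {:V'})`_j.
split=> [v|u] k x y; rewrite /=; first by rewrite fl scalerDr !scalerA mulrC.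
by rewrite fr scalerDr !scalerA mulrC.
Qed.

Lemma sigmaE (K : fieldType) (A : vectType K) (gr : bool -> {vspace A})
    (I : finType) (p q : I -> bool) (x y : I -> A) :
  super_grading gr ->
  (forall i, x i \in gr (p i)) -> (forall i, y i \in gr (q i)) ->
  sigma gr (\sum_i tens (x i) (y i)) =
  \sum_i (-1) ^+ (p i * q i)%N *: tens (y i) (x i).
Proof.
move=> gg xp yq.
have bt : bilinear_map (fun x y : A => tens y x).
  by have [tl tr] := @tens_bilinear K A A; split=> u; [exact: tr|exact: tl].
rewrite /sigma tensor_lift_sum; last exact: koszul_bilinear.
by apply: eq_bigr => i _; rewrite (koszulE (a := p i) (b := q i)).
Qed.

Lemma bracket12_13E (K : fieldType) (A : vectType K) (gr : bool -> {vspace A})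
    (br : A -> A -> A) (I : finType) (p q : I -> bool) (x y : I -> A)
    (r := \sum_i tens (x i) (y i)) :
  super_grading gr -> bilinear_map br ->
  (forall i, x i \in gr (p i)) -> (forall i, y i \in gr (q i)) ->
  bracket12_13 gr br r r =
  \sum_i \sum_j (-1) ^+ (p j * q i)%N *:
    tens (br (x i) (x j)) (tens (y i) (y j)).
Proof.
move=> gg [brl brr] xp yq.
have [tl tr] := @tens_bilinear K A (tensor A A).
have [tl2 tr2] := @tens_bilinear K A A.
have bk (x0 y' : A) : bilinear_map (fun u v : A => tens (br x0 u) (tens v y')).
  split=> [v|u] k s t /=; first by rewrite brr tl.
  by rewrite tl2 tr.
rewrite /bracket12_13 {1}/r tensor_lift_sum; last first.
  apply: tensor_lift_bilinear => x' y'; split=> [v|u].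
    by apply: koszul_linear => u' v' k s t; rewrite brl tl.
  exact: (koszul_bilinear _ _ (bk u y')).2.
apply: eq_bigr => i _; rewrite /r tensor_lift_sum; last first.
  split=> [v|u].
    exact: (koszul_bilinear _ _ (bk (x i) v)).1.
  by apply: koszul_linear => u' v' k s t; rewrite tr2 tr.
by apply: eq_bigr => j _; rewrite (koszulE (a := p j) (b := q i)).
Qed.

Lemma bracket12_23E (K : fieldType) (A : vectType K)
    (br : A -> A -> A) (I : finType) (x y : I -> A)
    (r := \sum_i tens (x i) (y i)) :
  bilinear_map br ->
  bracket12_23 br r r =
  \sum_i \sum_j tens (x i) (tens (br (y i) (x j)) (y j)).
Proof.
move=> [brl brr].
have [tl tr] := @tens_bilinear K A (tensor A A).
have [tl2 tr2] := @tens_bilinear K A A.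
rewrite /bracket12_23 {1}/r tensor_lift_sum; last first.
  apply: tensor_lift_bilinear => x' y'; split=> [v|u] k s t /=.
    by rewrite tl.
  by rewrite brl tl2 tr.
apply: eq_bigr => i _; rewrite /r tensor_lift_sum //.
split=> [v|u] k s t /=; first by rewrite brr tl2 tr.
by rewrite tr2 tr.
Qed.

Lemma bracket13_23E (K : fieldType) (A : vectType K) (gr : bool -> {vspace A})
    (br : A -> A -> A) (I : finType) (p q : I -> bool) (x y : I -> A)
    (r := \sum_i tens (x i) (y i)) :
  super_grading gr -> bilinear_map br ->
  (forall i, x i \in gr (p i)) -> (forall i, y i \in gr (q i)) ->
  bracket13_23 gr br r r =
  \sum_i \sum_j (-1) ^+ (p j * q i)%N *:
    tens (x i) (tens (x j) (br (y i) (y j))).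
Proof.
move=> gg [brl brr] xp yq.
have [tl tr] := @tens_bilinear K A (tensor A A).
have [tl2 tr2] := @tens_bilinear K A A.
have bk (x0 y' : A) : bilinear_map (fun u v : A => tens x0 (tens u (br v y'))).
  split=> [v|u] k s t /=; first by rewrite tl2 tr.
  by rewrite brl tr2 tr.
rewrite /bracket13_23 {1}/r tensor_lift_sum; last first.
  apply: tensor_lift_bilinear => x' y'; split=> [v|u].
    by apply: koszul_linear => u' v' k s t; rewrite tl.
  exact: (koszul_bilinear _ _ (bk u y')).2.
apply: eq_bigr => i _; rewrite /r tensor_lift_sum; last first.
  split=> [v|u].
    exact: (koszul_bilinear _ _ (bk (x i) v)).1.
  by apply: koszul_linear => u' v' k s t; rewrite brr tr2 tr.
by apply: eq_bigr => j _; rewrite (koszulE (a := p j) (b := q i)).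
Qed.

Lemma pairing_bilinear (K : fieldType) (A : vectType K) (f : 'Hom(A, K^o)) y :
  bilinear_map (fun (g : 'Hom(A, K^o)) x => f x * g y : K^o).
Proof.
split=> [v|u] k s t /=.
  by rewrite add_lfunE scale_lfunE mulrDr mulrCA.
by rewrite linearP /= mulrDl -scalerAl.
Qed.

Lemma tensor_pairing_bilinear (K : fieldType) (A : vectType K)
    (gr : bool -> {vspace A}) (f g : 'Hom(A, K^o)) :
  bilinear_map
    (fun x y => koszul (dual_gr gr) gr (fun g' x' => f x' * g' y : K^o) g x).
Proof.
split=> [v|u].
  exact: (koszul_bilinear _ _ (pairing_bilinear f v)).2.
apply: koszul_linear => g' x' k s t.
by rewrite linearP /= mulrDr -scalerAr.
Qed.

Lemma tensor_pairingE (K : fieldType) (A : vectType K) (gr : bool -> {vspace A})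
    (f g : 'Hom(A, K^o)) b (I : finType) (p : I -> bool) (x y : I -> A) :
  super_grading gr -> g \in dual_gr gr b -> (forall i, x i \in gr (p i)) ->
  tensor_pairing gr f g (\sum_i tens (x i) (y i)) =
  \sum_i (-1) ^+ (b * p i)%N * f (x i) * g (y i).
Proof.
move=> gg gb xp; rewrite /tensor_pairing tensor_lift_sum; last first.
  exact: tensor_pairing_bilinear.
apply: eq_bigr => i _; rewrite (koszulE (a := b) (b := p i)) ?mulrA //.
- by rewrite -mulrA.
- exact: dual_grading.
exact: pairing_bilinear.
Qed.

Lemma tensor_map_bilinear (K : fieldType) (A : vectType K) (f : 'Hom(A, K^o)) :
  bilinear_map (fun x y : A => (f x : K) *: y).
Proof.
split=> [v|u] k s t /=.
  by rewrite linearP /= scalerDl -scalerA.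
by rewrite scalerDr !scalerA mulrC.
Qed.

Lemma tensor_mapE (K : fieldType) (A : vectType K) (f : 'Hom(A, K^o))
    (I : finType) (x y : I -> A) :
  tensor_map (\sum_i tens (x i) (y i)) f = \sum_i (f (x i) : K) *: y i.
Proof. by rewrite /tensor_map tensor_lift_sum //; apply: tensor_map_bilinear. Qed.

Lemma tensor_mapP (K : fieldType) (A : vectType K) (gr : bool -> {vspace A})
    (a b : bool) (r : tensor A A) (f g : 'Hom(A, K^o)) :
  super_grading gr -> r \in tensor_gr gr gr false ->
  f \in dual_gr gr a -> g \in dual_gr gr b ->
  tensor_pairing gr f g r = (-1) ^+ (a * b)%N * g (tensor_map r f).
Proof.
move=> gg rc fa gb.
suff key d x y : x \in gr d -> y \in gr (d (+) false) ->
    tensor_pairing gr f g (tens x y) =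
    (-1) ^+ (a * b)%N * g (tensor_map (tens x y) f).
  have lin1 : linear (tensor_pairing gr f g) by exact: tensor_lift_is_linear.
  have lin2 : linear (fun r => (-1) ^+ (a * b)%N * g (tensor_map r f) : K^o).
    move=> k s t.
    rewrite (_ : tensor_map _ f = k *: tensor_map s f + tensor_map t f);
      last exact: tensor_lift_is_linear.
    by rewrite linearP /= mulrDr -scalerAr.
  move: rc; rewrite /tensor_gr => /memv_sumP[v vd ->].
  rewrite -[\sum_(i | _) v i](eq_bigr _ (fun i _ => scale1r (v i))).
  rewrite (linear_map_sum _ _ lin1) (linear_map_sum _ _ lin2).
  apply: eq_bigr => d _; congr (_ *: _).
  have /(@coord_span _ _ _ (in_tuple _)) -> := vd d isT.
  rewrite (linear_map_sum _ _ lin1) (linear_map_sum _ _ lin2).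
  apply: eq_bigr => i _; congr (_ *: _).
  have /allpairsP[[x y] /= [xd yd ->]] := mem_nth 0 (ltn_ord i).
  by apply: (key d); apply: vbasis_mem.
rewrite addbF => xd yd; rewrite /tensor_pairing tensor_lift_tens; last first.
  exact: tensor_pairing_bilinear.
rewrite (koszulE (dual_grading gg) gg (pairing_bilinear f y) gb xd).
rewrite /tensor_map (tensor_lift_tens _ _ (tensor_map_bilinear f)).
have -> k : g (k *: y) = k * g y by rewrite linearZ.
have scE (u v : K) : u *: (v : K^o) = u * v by [].
rewrite scE; have [/eqP -> |ad] := boolP (a == d); first by rewrite mulnC.
have -> : f x = 0.
  have ->: x = hpart gr (~~ a) x.
    by rewrite (hpart_homog _ gg xd); case: (a) (d) ad => [] [].
  by apply/(dual_grP gr a f) => //; apply: hpart_memv.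
by rewrite !(mul0r, mulr0).
Qed.

Lemma tensor_map_uniq (K : fieldType) (A : vectType K) (gr : bool -> {vspace A})
    (r : tensor A A) (h : 'Hom('Hom(A, K^o), A)) :
  super_grading gr -> r \in tensor_gr gr gr false ->
  (forall a b (f g : 'Hom(A, K^o)), f \in dual_gr gr a -> g \in dual_gr gr b ->
     tensor_pairing gr f g r = (-1) ^+ (a * b)%N * g (h f)) ->
  h =1 tensor_map r.
Proof.
move=> gg rc hP.
have dg := dual_grading gg.
have eqg a f (g : 'Hom(A, K^o)) : f \in dual_gr gr a ->
    g (h f) = g (tensor_map r f).
  move=> fa; rewrite -(hpartD true g dg) !add_lfunE; congr (_ + _);
  [set b := true|set b := ~~ true];
  apply: (@mulfI _ ((-1) ^+ (a * b)%N)); rewrite ?signr_eq0 //;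
  by rewrite -(hP a b f _ fa (hpart_memv _ _ _))
             (tensor_mapP gg rc fa (hpart_memv _ b _)).
have eqh a f : f \in dual_gr gr a -> h f = tensor_map r f.
  move=> fa; rewrite [LHS](coord_vbasis (memvf _)).
  rewrite [RHS](coord_vbasis (memvf _)); apply: eq_bigr => i _; congr (_ *: _).
  have lin : linear (coord (vbasis {:A}) i : A -> K^o) by exact: linearP.
  have := eqg a f (linfun (coord (vbasis {:A}) i : A -> K^o)) fa.
  by rewrite !(linfunE lin).
move=> f; rewrite -(hpartD true f dg) linearD /=.
have -> (f1 f2 : 'Hom(A, K^o)) :
    tensor_map r (f1 + f2) = tensor_map r f1 + tensor_map r f2.
  rewrite /tensor_map /tensor_lift -big_split; apply: eq_bigr => i _ /=.
  rewrite -big_split; apply: eq_bigr => j _ /=; rewrite -scalerDr.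
  by rewrite add_lfunE scalerDl.
by congr (_ + _); apply: eqh; apply: hpart_memv.
Qed.

Lemma supercommE (K : fieldType) (P : vectType K) (gr : bool -> {vspace P})
    (mul : P -> P -> P) a b x y :
  super_grading gr -> bilinear_map mul -> x \in gr a -> y \in gr b ->
  supercomm gr mul x y = mul x y - (-1) ^+ (a * b)%N *: mul y x.
Proof.
move=> gg [ml mr] xa yb.
by rewrite /supercomm (koszulE (a := a) (b := b)).
Qed.

(* Main.v *)
Require Import Defs.
From HB Require Import structures.
From mathcomp Require Import all_boot all_order all_algebra.
Set Implicit Arguments.
Unset Strict Implicit.
Unset Printing Implicit Defensive.
Import GRing.Theory.
Local Open Scope ring_scope.

(** Write R for the map [tensor_map r].

    The Yang-Baxter element lives in the triple tensor product of A.  Such an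
    element vanishes as soon as its contractions with homogeneous forms f and g
    on its first two factors vanish in A ([contract_homog_inj]).  Write r as a sum
    of tens (x i) (y i) with x i and y i of one and the same parity, which is
    what evenness of r gives ([even_tensorP]).  Since f (x i) = 0 unless x i
    has the parity of f, every Koszul sign may be expressed with the parities
    of f and g alone ([dual_sign]), and the three brackets contract, up to the
    common sign (-1)^{|f||g|}, to
      - [r13, r23] : [R f, R g];
      - [r12, r23] : - R (ad* (R f) g);
      - [r12, r13] : (-1)^{|f||g|} R (ad* (R g) f).
    In the last case g meets the second leg of r instead of the first, which
    is where skew-supersymmetry enters.  The sum is the defect of the operator
    identity ([contract_yang_baxter]), hence the equivalence [yang_baxterP].

    For the second claim, the operator identity says that R carries the
    supercommutator of the product f . g = ad* (R f) g to the bracket of A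
    ([tensor_map_supercomm]).  The pre-Malcev identity at x, y, z, t thereby
    becomes an identity between operators ad* of R x, R y, R z and their
    brackets, applied to t.  It holds for any three elements of A
    ([ad_dual_malcev]): evaluated at w, it is, up to sign, t applied to the
    Malcev identity with all brackets turned so that w is innermost
    ([malcev_adjoint]). *)

(** * Linear maps given by a proof of linearity *)

Lemma linear_mapB (K : fieldType) (U W : vectType K) (g : U -> W) :
  linear g -> {morph g : x y / x - y}.
Proof.
by move=> lg x y; rewrite addrC -scaleN1r lg scaleN1r addrC.
Qed.

Lemma linear_mapZ (K : fieldType) (U W : vectType K) (g : U -> W) k :
  linear g -> {morph g : x / k *: x}.
Proof. by move=> lg x; rewrite -[k *: x]addr0 lg (linear_map0 lg) addr0. Qed.

Lemma linear_mapN (K : fieldType) (U W : vectType K) (g : U -> W) :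
  linear g -> {morph g : x / - x}.
Proof. by move=> lg x; rewrite -!scaleN1r linear_mapZ. Qed.

Lemma linear_mapD (K : fieldType) (U W : vectType K) (g : U -> W) :
  linear g -> {morph g : x y / x + y}.
Proof. by move=> lg x y; rewrite -[x]scale1r lg !scale1r. Qed.

Lemma linear_map_bigsum (K : fieldType) (U W : vectType K) (g : U -> W)
    (I : finType) (x : I -> U) :
  linear g -> g (\sum_i x i) = \sum_i g (x i).
Proof.
move=> lg; have := linear_map_sum (fun=> 1) x lg.
by under eq_bigr do rewrite scale1r; under [in RHS]eq_bigr do rewrite scale1r.
Qed.

Lemma eq_signZ (K : fieldType) (V : vectType K) (m n : nat) (v : V) :
  odd m = odd n -> (-1) ^+ m *: v = (-1) ^+ n *: v.
Proof. by move=> mn; rewrite -[in LHS]signr_odd mn signr_odd. Qed.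

(** * Contraction of the first tensor factor *)

Section Contraction.
Variables (K : fieldType) (U V : vectType K).

(** For V = U this is [tensor_map], by conversion; a general V makes it possible
    to contract an element of a triple tensor product twice. *)
Definition contract (f : 'Hom(U, K^o)) : tensor U V -> V :=
  tensor_lift (fun x y => (f x : K) *: y).

Lemma contract_is_linear f : linear (contract f).
Proof. exact: tensor_lift_is_linear. Qed.

Lemma contract_tens f x y : contract f (tens x y) = (f x : K) *: y.
Proof.
rewrite /contract tensor_lift_tens //; split=> [v|u] k s t /=.
  by rewrite linearP /= scalerDl -scalerA.
by rewrite scalerDr !scalerA mulrC.
Qed.

Lemma contract_linear_l r : linear (contract ^~ r).
Proof.
move=> k f g; rewrite /contract /tensor_lift scaler_sumr -big_split.
apply: eq_bigr => i _ /=; rewrite scaler_sumr -big_split.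
apply: eq_bigr => j _ /=; rewrite add_lfunE scale_lfunE scalerDl scalerDr.
by rewrite !scalerA -mulrA [in RHS]mulrCA.
Qed.

(** Contracting with the coordinate form of index i yields the vector whose
    coordinates are the i-th row of the tensor. *)
Lemma contract_inj (r : tensor U V) : (forall f, contract f r = 0) -> r = 0.
Proof.
move=> r0; apply/matrixP => i j; rewrite [RHS]mxE.
have lin : linear (coord (vbasis {:U}) i : U -> K^o) by exact: linearP.
have := r0 (linfun (coord (vbasis {:U}) i : U -> K^o)).
rewrite /contract /tensor_lift (bigD1 i) //= [X in _ + X]big1 ?addr0.
  under eq_bigr do rewrite (linfunE lin) coord_free ?(basis_free (vbasisP _)) //.
  under eq_bigr do rewrite eqxx scale1r.
  move=> s0; have /freeP fr := basis_free (vbasisP {:V}); exact: fr s0 j.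
move=> i' /negPf ii; apply: big1 => j' _.
rewrite (linfunE lin) coord_free ?(basis_free (vbasisP _)) //.
by rewrite ii scale0r scaler0.
Qed.

End Contraction.

(** * Even tensors *)

(** The projection P onto the even tensors is the sum over b of the tensor
    squares of the projections [hpart gr b].  It fixes r, and applied to the
    expansion of r in the tensor basis it gives homogeneous terms. *)
Lemma even_tensorP (K : fieldType) (A : vectType K) (gr : bool -> {vspace A})
    (r : tensor A A) :
  super_grading gr -> r \in tensor_gr gr gr false ->
  exists (I : finType) (p : I -> bool) (x y : I -> A),
    [/\ forall i, x i \in gr (p i), forall i, y i \in gr (p i)
      & r = \sum_i tens (x i) (y i)].
Proof.
move=> gg rc.
have [tl tr] := @tens_bilinear K A A.
pose P : tensor A A -> tensor A A :=
  tensor_lift (fun x y => \sum_b tens (hpart gr b x) (hpart gr b y)).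
have bP : bilinear_map
    (fun x y : A => \sum_b tens (hpart gr b x) (hpart gr b y)).
  apply: bilinear_map_sum => b.
  by split=> u k s t; rewrite linearP ?tl ?tr.
have lP : linear P by exact: tensor_lift_is_linear.
have Pr : P r = r.
  move: rc; rewrite /tensor_gr => /memv_sumP[v vd ->].
  rewrite (linear_map_bigsum _ lP); apply: eq_bigr => d _.
  have /(@coord_span _ _ _ (in_tuple _)) -> := vd d isT.
  rewrite (linear_map_sum _ _ lP); apply: eq_bigr => i _; congr (_ *: _).
  have /allpairsP[[x y] /= [/vbasis_mem xd /vbasis_mem yd ->]] :=
    mem_nth 0 (ltn_ord i).
  rewrite addbF in yd; rewrite /P tensor_lift_tens // (bigD1 d) //= !hpart_id //.
  rewrite big1 ?addr0 // => b /negPf bd.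
  by rewrite !(hpart_homog _ gg (b := d)) // bd (linear_map0 (tl _)).
pose n := \dim {:A}; pose e (i : 'I_n) := (vbasis {:A})`_i.
exists ('I_n * 'I_n * bool)%type, (fun u => u.2).
exists (fun u => (r : 'M_(_, _)) u.1.1 u.1.2 *: hpart gr u.2 (e u.1.1)).
exists (fun u => hpart gr u.2 (e u.1.2)); split=> [u|u|].
- by apply/memvZ/hpart_memv.
- exact: hpart_memv.
rewrite -[LHS]Pr /P /tensor_lift pair_big /= -/n.
under eq_bigr do rewrite scaler_sumr.
rewrite pair_big /=; apply: eq_bigr => u _.
by rewrite (linear_mapZ _ (tl _)).
Qed.

(** * Forms on a superalgebra and the Yang-Baxter equation *)

Section SuperDual.
Variables (K : fieldType) (A : vectType K) (gr : bool -> {vspace A}).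
Hypothesis gg : super_grading gr.

(** Exchanges the parity of an argument for that of the form applied to it: if
    they differ, both sides vanish. *)
Lemma dual_sign a b (c : nat) (f : 'Hom(A, K^o)) x :
  f \in dual_gr gr a -> x \in gr b ->
  (-1) ^+ (b * c)%N * f x = (-1) ^+ (a * c)%N * f x.
Proof.
move=> /dual_grP fa xb; have [->//|ab] := eqVneq a b.
by rewrite fa ?mulr0 //; case: a b ab xb {fa} => [] [].
Qed.

Lemma eq_dual_homog (f g : 'Hom(A, K^o)) :
  (forall b x, x \in gr b -> f x = g x) -> f = g.
Proof.
move=> fg; apply/lfunP => x; rewrite -(hpartD false x gg) !linearD /=.
by congr (_ + _); apply: fg; apply: hpart_memv.
Qed.

Variable br : A -> A -> A.
Hypotheses (bb : bilinear_map br) (eb : even_product gr br).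

Lemma ad_dual_bilinear : bilinear_map (ad_dual gr br).
Proof.
apply: koszul_bilinear.
have linE u (g : 'Hom(A, K^o)) z :
    linfun (fun y : A => - g (br u y) : K^o) z = - g (br u z).
  have lin : linear (fun y : A => - g (br u y) : K^o).
    by move=> k v w; rewrite bb.2 linearP opprD scalerN.
  exact: linfunE.
split=> [v|u] k w z; apply/lfunP => t; rewrite add_lfunE scale_lfunE !linE.
  by rewrite bb.1 linearP opprD scalerN.
by rewrite add_lfunE scale_lfunE opprD scalerN.
Qed.

Lemma ad_dual_even a b x f : x \in gr a -> f \in dual_gr gr b ->
  ad_dual gr br x f \in dual_gr gr (a (+) b).
Proof.
move=> xa fb; apply/dual_grP => y yc.
rewrite (ad_dualE _ gg bb xa fb).
have /dual_grP -> := fb; first by rewrite mulr0 oppr0.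
by have := eb xa yc; congr (_ \in gr _); case: (a) (b) => [] [].
Qed.

Lemma tensor_map_even (r : tensor A A) a f :
  r \in tensor_gr gr gr false -> f \in dual_gr gr a -> tensor_map r f \in gr a.
Proof.
move=> re fa; have [I [p [x [y [xp yp ->]]]]] := even_tensorP gg re.
rewrite tensor_mapE; apply: memv_suml => i _.
have [<-|pa] := eqVneq (p i) a; first exact/memvZ.
have /dual_grP -> := fa; first by rewrite scale0r mem0v.
by have := xp i; case: (p i) (a) pa => [] [].
Qed.

Lemma tensor_map_is_linear (r : tensor A A) : linear (tensor_map r).
Proof. exact: contract_linear_l. Qed.

(** Contracting the first two factors expresses each bracket
    through values of R.  In [r12, r13], however, f takes
    the bracket of two first legs and g a second leg; by skew-supersymmetry the
    sum of the g (y i) *: x i that occurs there is R g up to a sign ([RgE]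
    below). *)
Lemma contract_yang_baxter (r : tensor A A) a b (f g : 'Hom(A, K^o)) :
  skew_supersymmetric gr r -> r \in tensor_gr gr gr false ->
  f \in dual_gr gr a -> g \in dual_gr gr b ->
  contract g (contract f
    (bracket12_13 gr br r r + bracket12_23 br r r + bracket13_23 gr br r r)) =
  (-1) ^+ (a * b)%N *: (br (tensor_map r f) (tensor_map r g)
    - tensor_map r (ad_dual gr br (tensor_map r f) g
        - (-1) ^+ (a * b)%N *: ad_dual gr br (tensor_map r g) f)).
Proof.
move=> rs re fa gb.
have Rf := tensor_map_even re fa; have Rg := tensor_map_even re gb.
have [I [p [x [y [xp yp rE]]]]] := even_tensorP gg re.
have RE h : tensor_map r h = \sum_i (h (x i) : K) *: y i.
  by rewrite rE tensor_mapE.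
have RgE : tensor_map r g = - ((-1) ^+ b *: \sum_i (g (y i) : K) *: x i).
  rewrite rs rE (sigmaE gg xp yp) -[tensor_map _ g]/(contract g _).
  rewrite (linear_mapN (contract_is_linear g)).
  rewrite (linear_map_sum _ _ (contract_is_linear g)) scaler_sumr.
  congr (- _); apply: eq_bigr => i _; rewrite contract_tens !scalerA.
  congr (_ *: _); have := dual_sign 1 gb (yp i).
  by rewrite !muln1 mulnb andbb.
have cE h k c u v w : contract k (contract h (c *: tens u (tens v w))) =
    (c * (h u * k v)) *: w :> A.
  rewrite (linear_mapZ _ (contract_is_linear h)) contract_tens.
  by rewrite !(linear_mapZ _ (contract_is_linear k)) contract_tens !scalerA mulrA.
have lc : linear (fun T => contract g (contract f T) : A).
  by move=> k s t; rewrite !contract_is_linear.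
rewrite !(linear_mapD lc) [in LHS]rE.
rewrite (bracket12_13E gg bb xp yp) (bracket12_23E _ _ bb).
rewrite (bracket13_23E gg bb xp yp).
have lsum (F : I -> I -> tensor A (tensor A A)) :
    contract g (contract f (\sum_i \sum_j F i j)) =
    \sum_i \sum_j contract g (contract f (F i j)) :> A.
  rewrite (linear_map_bigsum _ lc); apply: eq_bigr => i _.
  by rewrite (linear_map_bigsum _ lc).
have bl u : linear (br^~ u) by exact: bb.1.
have brr u : linear (br u) by exact: bb.2.
have T13 : \sum_i \sum_j contract g (contract f ((-1) ^+ (p j * p i) *:
      tens (x i) (tens (x j) (br (y i) (y j))))) =
    (-1) ^+ (a * b) *: br (tensor_map r f) (tensor_map r g).
  rewrite !RE (linear_map_sum _ _ (bl _)) scaler_sumr; apply: eq_bigr => i _.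
  rewrite (linear_map_sum _ _ (brr _)) !scaler_sumr; apply: eq_bigr => j _.
  rewrite cE !scalerA; congr (_ *: _).
  rewrite mulrA mulnC (dual_sign _ fa (xp i)) -mulrA mulrCA mulnC.
  by rewrite (dual_sign _ gb (xp j)) mulnC mulrCA [f _ * _]mulrC !mulrA.
have T23 : \sum_i \sum_j contract g (contract f (
      tens (x i) (tens (br (y i) (x j)) (y j)))) =
    - ((-1) ^+ (a * b) *: tensor_map r (ad_dual gr br (tensor_map r f) g)).
  rewrite exchange_big [in RHS]RE scaler_sumr -sumrN; apply: eq_bigr => j _.
  rewrite scalerA -scaleNr (ad_dualE _ gg bb Rf gb) mulrN opprK mulrA.
  rewrite -expr2 sqrr_sign mul1r.
  rewrite RE (linear_map_sum _ _ (bl _)) linear_sum scaler_suml.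
  apply: eq_bigr => i _; rewrite -[tens _ _]scale1r cE mul1r.
  by rewrite linearZ.
have T12 : \sum_i \sum_j contract g (contract f ((-1) ^+ (p j * p i) *:
      tens (br (x i) (x j)) (tens (y i) (y j)))) =
    tensor_map r (ad_dual gr br (tensor_map r g) f).
  rewrite exchange_big [in RHS]RE; apply: eq_bigr => j _.
  have adgf := ad_dual_even Rg fa.
  transitivity ((((-1) ^+ (p j * b) * f (br (\sum_i (g (y i) : K) *: x i) (x j)))
     : K) *: y j).
    rewrite (linear_map_sum _ _ (bl _)) linear_sum mulr_sumr scaler_suml.
    apply: eq_bigr => i _; rewrite cE; congr (_ *: _).
    rewrite linearZ mulnC [f _ * _]mulrC mulrA (dual_sign _ gb (yp i)).
    by rewrite mulnC mulrA.
  congr (_ *: _).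
  (* The form w |-> f [R g, w] has parity a (+) b, so the sign that depends on
     x j becomes one in a and b, which cancels the remaining ones. *)
  have -> : \sum_i (g (y i) : K) *: x i = - ((-1) ^+ b *: tensor_map r g).
    by rewrite RgE scalerN opprK scalerA -expr2 sqrr_sign scale1r.
  rewrite (linear_mapN (bl _)) (linear_mapZ _ (bl _)) linearN linearZ /=.
  have -> : f (br (tensor_map r g) (x j)) =
      - ((-1) ^+ (b * a) * ad_dual gr br (tensor_map r g) f (x j)).
    by rewrite (ad_dualE _ gg bb Rg fa) mulrN opprK mulrA -expr2 sqrr_sign mul1r.
  have scE (u v : K) : u *: (v : K^o) = u * v by [].
  rewrite scalerN opprK scE mulrCA [_ ^+ (p j * b) * _]mulrCA.
  rewrite (dual_sign b adgf (xp j)) !mulrA -!exprD -signr_odd.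
  by rewrite (_ : odd _ = false) ?mul1r //; clear; case: a b => [] [].
rewrite !lsum T12 T23 T13 (linear_mapB (tensor_map_is_linear r)).
rewrite (linear_mapZ _ (tensor_map_is_linear r)) !scalerBr scalerA.
by rewrite -expr2 sqrr_sign scale1r opprB addrC addrA.
Qed.

Lemma contract_homog_inj (V : vectType K) (T : tensor A V) :
  (forall a (f : 'Hom(A, K^o)), f \in dual_gr gr a -> contract f T = 0) ->
  T = 0.
Proof.
move=> T0; apply: contract_inj => f.
rewrite -(hpartD false f (dual_grading gg)) (linear_mapD (contract_linear_l T)).
by rewrite (T0 _ _ (hpart_memv _ false f)) (T0 _ _ (hpart_memv _ true f)) addr0.
Qed.

Lemma yang_baxterP (r : tensor A A) :
  skew_supersymmetric gr r -> r \in tensor_gr gr gr false ->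
  super_malcev_yang_baxter gr br r <->
  forall (a b : bool) (f g : 'Hom(A, K^o)),
    f \in dual_gr gr a -> g \in dual_gr gr b ->
    br (tensor_map r f) (tensor_map r g) =
    tensor_map r
      (ad_dual gr br (tensor_map r f) g
       - (-1) ^+ (a * b)%N *: ad_dual gr br (tensor_map r g) f).
Proof.
move=> rs re; split=> [yb a b f g fa gb|rot].
  apply/eqP; rewrite -subr_eq0 -(can_eq (signrZK (a * b)%N)) /= scaler0; apply/eqP.
  rewrite -(contract_yang_baxter rs re fa gb) yb.
  by rewrite !(linear_map0 (contract_is_linear _)).
apply: contract_homog_inj => a f fa; apply: contract_homog_inj => b g gb.
by rewrite (contract_yang_baxter rs re fa gb) (rot a b) // subrr scaler0.
Qed.

(** * The product on the dual space *)

Section OperatorIdentity.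
Variable r : tensor A A.
Hypothesis re : r \in tensor_gr gr gr false.
Hypothesis rot : forall (a b : bool) (f g : 'Hom(A, K^o)),
  f \in dual_gr gr a -> g \in dual_gr gr b ->
  br (tensor_map r f) (tensor_map r g) =
  tensor_map r
    (ad_dual gr br (tensor_map r f) g
     - (-1) ^+ (a * b)%N *: ad_dual gr br (tensor_map r g) f).

Let mul (f g : 'Hom(A, K^o)) := ad_dual gr br (tensor_map r f) g.

Lemma dual_product_bilinear : bilinear_map mul.
Proof.
split=> [g|f] k s t; rewrite /mul; last exact: ad_dual_bilinear.2.
by rewrite tensor_map_is_linear ad_dual_bilinear.1.
Qed.

Lemma dual_product_even : even_product (dual_gr gr) mul.
Proof. by move=> a b f g fa gb; apply/ad_dual_even/gb/tensor_map_even. Qed.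

(** The operator identity is exactly multiplicativity of R for this bracket. *)
Lemma tensor_map_supercomm a b f g :
  f \in dual_gr gr a -> g \in dual_gr gr b ->
  tensor_map r (supercomm (dual_gr gr) mul f g)
  = br (tensor_map r f) (tensor_map r g).
Proof.
move=> fa gb; rewrite (rot fa gb).
by rewrite (supercommE (dual_grading gg) dual_product_bilinear fa gb).
Qed.

Lemma dual_supercomm_even : even_product (dual_gr gr) (supercomm (dual_gr gr) mul).
Proof.
move=> a b f g fa gb.
rewrite (supercommE (dual_grading gg) dual_product_bilinear fa gb).
apply: memvB; first exact: dual_product_even.
by apply: memvZ; rewrite addbC; apply: dual_product_even.
Qed.

End OperatorIdentity.

End SuperDual.

(** * The coadjoint action of a Malcev superalgebra *)

Section Malcev.
Variables (K : fieldType) (A : vectType K) (gr : bool -> {vspace A}).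
Variable br : A -> A -> A.
Hypothesis mA : malcev_superalgebra gr br.

(** The Malcev identity as a relation between adjoint operators applied to w:
    skew-supersymmetry moves w to the innermost right position, and all signs
    involving the parity of w cancel. *)
Lemma malcev_adjoint a b c d x y z w :
  x \in gr a -> y \in gr b -> z \in gr c -> w \in gr d ->
  br x (br (br y z) w) - br (br (br x y) z) w
  + (-1) ^+ (b * c)%N *: br (br x z) (br y w)
  + (-1) ^+ (a * b + a * c + b * c)%N *: br z (br y (br x w))
  - (-1) ^+ (a * b)%N *: br y (br x (br z w)) = 0.
Proof.
have [gg [bl brr] eb sk mi] := mA => xa yb zc wd.
rewrite (mi a b c d) //.
have yz := eb _ _ _ _ yb zc; have zw := eb _ _ _ _ zc wd.
have wx := eb _ _ _ _ wd xa.
rewrite (sk _ _ _ _ (eb _ _ _ _ yz wd) xa).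
rewrite (sk _ _ _ _ (eb _ _ _ _ zw xa) yb) (sk _ _ _ _ zw xa).
rewrite (sk _ _ _ _ (eb _ _ _ _ wx yb) zc) (sk _ _ _ _ wx yb).
rewrite (sk _ _ _ _ wd xa).
rewrite !(linear_mapN (brr _)) !(linear_mapZ _ (brr _)).
rewrite !(linear_mapN (brr _)) !(linear_mapZ _ (brr _)).
rewrite ?scalerN ?opprK !scalerA.
set t1 := br x _; set t2 := br _ w; set t3 := br y _; set t4 := br z _.
rewrite -!exprD.
rewrite (eq_signZ (n := 0) t1); last by clear; case: a b c d => [] [] [] [].
rewrite (eq_signZ (n := a * b) t3); last by clear; case: a b c d => [] [] [] [].
rewrite (eq_signZ (n := a * b + a * c + b * c) t4);
  last by clear; case: a b c d => [] [] [] [].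
by rewrite scale1r !addrA subrK subrK subrr add0r subrr.
Qed.

(** Dualising reverses the order of composition, which turns the terms of
    [malcev_adjoint] into those of the pre-Malcev identity; the signs produced
    by the coadjoint action differ from those there by the common factor
    (-1)^{(a+b+c)d}. *)
Lemma ad_dual_malcev a b c d x y z (t : 'Hom(A, K^o)) :
  x \in gr a -> y \in gr b -> z \in gr c -> t \in dual_gr gr d ->
  (-1) ^+ (a * (b + c))%N *: ad_dual gr br (br y z) (ad_dual gr br x t)
  + ad_dual gr br (br (br x y) z) t
  + (-1) ^+ (a * b)%N *: ad_dual gr br y (ad_dual gr br (br x z) t)
  - ad_dual gr br x (ad_dual gr br y (ad_dual gr br z t))
  + (-1) ^+ (c * (a + b))%N *:
      ad_dual gr br z (ad_dual gr br x (ad_dual gr br y t)) = 0.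
Proof.
have [gg bb eb sk mi] := mA => xa yb zc td.
have ev := ad_dual_even gg bb eb; have adE := ad_dualE _ gg bb.
have xy := eb _ _ _ _ xa yb; have xz := eb _ _ _ _ xa zc.
have yz := eb _ _ _ _ yb zc; have xyz := eb _ _ _ _ xy zc.
apply: (eq_dual_homog gg) => e w we; rewrite zero_lfunE.
rewrite !(add_lfunE, scale_lfunE, opp_lfunE).
rewrite (adE _ _ _ _ _ yz (ev _ _ _ _ xa td)) (adE _ _ _ _ _ xa td).
rewrite (adE _ _ _ _ _ xyz td) (adE _ _ _ _ _ yb (ev _ _ _ _ xz td)).
rewrite (adE _ _ _ _ _ xz td).
rewrite (adE _ _ _ _ _ xa (ev _ _ _ _ yb (ev _ _ _ _ zc td))).
rewrite (adE _ _ _ _ _ yb (ev _ _ _ _ zc td)) (adE _ _ _ _ _ zc td).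
rewrite (adE _ _ _ _ _ zc (ev _ _ _ _ xa (ev _ _ _ _ yb td))).
rewrite (adE _ _ _ _ _ xa (ev _ _ _ _ yb td)) (adE _ _ _ _ _ yb td).
have scE (u v : K) : u *: (v : K^o) = u * v by [].
rewrite !scE !(mulrN, opprK) !mulrA -!exprD.
have := congr1 (fun v => (-1) ^+ ((a + b + c) * d)%N * t v)
  (malcev_adjoint xa yb zc we).
rewrite !(linearB, linearD, linearZ) /= linear0 mulr0 !scE.
rewrite !(mulrDr, mulrN) !mulrA -!exprD => <-.
by congr (_ - _ + _ + _ - _); apply: (eq_signZ (V := K^o));
  clear; case: a b c d => [] [] [] [].
Qed.

End Malcev.

Theorem theorem4p1 (K : closedFieldType) (charK0 : [pchar K] =i pred0)
    (A : vectType K) (gr : bool -> {vspace A}) (br : A -> A -> A)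
    (malcevA : malcev_superalgebra gr br)
    (r : tensor A A) (r_skew : skew_supersymmetric gr r)
    (r_even : r \in tensor_gr gr gr false) :
  (super_malcev_yang_baxter gr br r <->
   forall (a b : bool) (f g : 'Hom(A, K^o)),
     f \in dual_gr gr a -> g \in dual_gr gr b ->
     br (tensor_map r f) (tensor_map r g) =
     tensor_map r
       (ad_dual gr br (tensor_map r f) g
        - (-1) ^+ (a * b)%N *: ad_dual gr br (tensor_map r g) f))
  /\ (super_malcev_yang_baxter gr br r ->
      pre_malcev_superalgebra (dual_gr gr)
        (fun f g : 'Hom(A, K^o) => ad_dual gr br (tensor_map r f) g)).
Proof.
have [gg bb eb _ _] := malcevA.
have ybP := yang_baxterP gg bb eb r_skew r_even.
split=> // /ybP rot; split.
- exact: dual_grading.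
- exact: dual_product_bilinear.
- exact: dual_product_even.
have RE := tensor_map_supercomm gg bb rot.
have ev_sc := dual_supercomm_even gg bb eb r_even.
have ev_R a f := @tensor_map_even _ _ _ gg r a f r_even.
(* The rest follows from multiplicativity and evenness of R; hiding its
   definition keeps unification from unfolding sums over bases. *)
move: (supercomm _ _) RE ev_sc => sc; move: (tensor_map r) ev_R => R ev_R RE ev_sc.
move=> a b c d x y z t xa yb zc td; have xy := ev_sc _ _ _ _ xa yb.
rewrite (RE _ _ _ _ yb zc) (RE _ _ _ _ xy zc) (RE _ _ _ _ xa yb) (RE _ _ _ _ xa zc).
exact: (ad_dual_malcev malcevA (ev_R _ _ xa) (ev_R _ _ yb) (ev_R _ _ zc) td).
Qed.
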